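(* Let $K:\mathbb{Z}^2\to[0,\infty)$ satisfy $\sup_{k,l\in\mathbb{Z}}K(k,l)\le C_K$ for some $C_K\in(0,\infty)$. Let $f_0\in\ell_1(\mathbb{Z})$ be nonnegative with $m(f_0)>0$, and let $f$ be the corresponding solution of $\dot f(t)=Q(f(t))$, $t>0$, $f(0)=f_0$; write $f(t,k)=f(t)(k)$. Then the following statements hold. (i) If $K(k,l)>0$ for all $k,l\in\mathbb{Z}$, then $f(t,k)>0$ for all $t>0$ and all $k\in\mathbb{Z}$. (ii) Assume in addition that $K(k,l)\ge c_K$ for all $k,l\in\mathbb{Z}$ with some $c_K>0$. Let $(a_n)_{n\in\mathbb{N}}\subset(0,\infty)$ be such that $\sigma:=\sum_{j=1}^\infty a_j<\infty$, put $\sigma_n:=\sum_{j=1}^n a_j$ for $n\in\mathbb{N}$ and $\sigma_0:=0$, let $t_0>0$, and let $f_0(k)>0$ for some fixed $k\in\mathbb{Z}$. Then $$f(t,k+l)\ge\big(c_Km(f_0)\big)^{|l|}f_0(k)\,e^{-2C_Km(f_0)t}\prod_{j=1}^{|l|}\Big(2C_K+\frac{\sigma}{t_0a_j}\Big)^{-1}$$ for all $l\in\mathbb{Z}$ and all $t\ge t_0\frac{\sigma_{|l|}}{\sigma}$. If in addition $(a_n)_{n\in\mathbb{N}}$ is monotonically nonincreasing, then in particular $$f(t,k+l)\ge\big(c_Km(f_0)\big)^{|l|}f_0(k)\,e^{-2C_Km(f_0)t}\Big(2C_K+\frac{\sigma}{t_0a_{|l|}}\Big)^{-|l|}$$ for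 all $l\in\mathbb{Z}$ and all $t\ge t_0\frac{\sigma_{|l|}}{\sigma}$.
   Context: $\ell_1(\mathbb{Z})$ is the Banach space of real functions $g:\mathbb{Z}\to\mathbb{R}$ with $\|g\|_1=\sum_{k\in\mathbb{Z}}|g(k)|<\infty$; $m(g)=\sum_{k\in\mathbb{Z}}g(k)$. $\mathbb{N}=\{1,2,\dots\}$. The collision operator associated with $K$ is $Q(f)=Q(f,f)$, where for $k\in\mathbb{Z}$ $$Q(f,g)(k)=\sum_{l\in\mathbb{Z}}\Big(K(l,k-1)g(l)f(k-1)-K(k,l-1)f(k)g(l-1)-K(l,k)g(l)f(k)+K(k+1,l-1)f(k+1)g(l-1)\Big).$$ For bounded $K$ and nonnegative $f_0\in\ell_1(\mathbb{Z})$, the initial value problem has a unique global solution $f\in C^1([0,\infty);\ell_1(\mathbb{Z}))$, which is nonnegative and conserves $m$; this is ''the corresponding solution''. For $l=0$ empty products equal $1$, and the factor $(\,\cdot\,)^{-|l|}$ in the last estimate is read as $1$. *)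

(* Defs.v *)
From HB Require Import structures.
From mathcomp Require Import all_boot all_order all_algebra.
From mathcomp Require Import all_classical all_reals all_analysis.

Set Implicit Arguments.
Unset Strict Implicit.
Unset Printing Implicit Defensive.

Import Order.TTheory GRing.Theory Num.Theory.
Import numFieldNormedType.Exports.

Local Open Scope classical_set_scope.
Local Open Scope ring_scope.

HB.instance Definition _ := isPointed.Build int 0.

(* All subsets of [int] are measurable, so that sums over the integers are
   integrals with respect to the counting measure. *)
HB.instance Definition _ := @isMeasurable.Build default_measure_display
  int discrete_measurable discrete_measurable0
  discrete_measurableC discrete_measurableU.

Section Definitions.
Context {R : realType}.
Implicit Types (K : int -> int -> R) (f g : int -> R) (u v : R -> int -> R).

(* [sumZ g] is the sum of an absolutely summable [g]; its value is
   meaningless for other [g], so [sumZ] and [norm1] are only to be read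
   together with [ell1]. *)
Definition sumZ g : R := \int[counting]_k g k.

Definition ell1 : set (int -> R) :=
  [set g | counting.-integrable setT (EFin \o g)].

Definition norm1 g : R := sumZ (fun k => `|g k|).

Definition mass g : R := sumZ g.

Definition collision2 K f g (k : int) : R :=
  sumZ (fun l => K l (k - 1) * g l * f (k - 1)
               - K k (l - 1) * f k * g (l - 1)
               - K l k * g l * f k
               + K (k + 1) (l - 1) * f (k + 1) * g (l - 1)).

Definition collision K f : int -> R := collision2 K f f.

(* [v] is the derivative of [u] on [0, oo[ as a curve in ell1, the limit of the
   difference quotients being taken in [norm1] and one-sided at 0; values at
   negative times play no role. *)
Definition derivative_ell1 u v :=
  forall t : R, 0 <= t ->
    norm1 (fun k => (s - t)^-1 * (u s k - u t k) - v t k)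
      @[s --> within `[0, +oo[ t^'] --> 0.

Definition continuous_ell1 v :=
  forall t : R, 0 <= t ->
    norm1 (fun k => v s k - v t k) @[s --> within `[0, +oo[ (nbhs t)] --> 0.

(* [u] belongs to C^1([0, oo[; ell1), with derivative [v]. *)
Definition C1_ell1 u v :=
  [/\ forall t : R, 0 <= t -> ell1 (u t) /\ ell1 (v t),
      derivative_ell1 u v & continuous_ell1 v].

Definition is_solution K f0 u :=
  exists v, [/\ C1_ell1 u v,
    forall t : R, 0 < t -> v t =1 collision K (u t) & u 0 =1 f0].

(* The sequence [a] is indexed from 1; [a 0] is never used. *)
Definition psum (a : nat -> R) (n : nat) : R := \sum_(1 <= j < n.+1) a j.

End Definitions.

(* Main.v *)
(** With the rates A_k = sum_l K(l,k) f_l and B_k = sum_l K(k,l) f_l, the equation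
    reads f_k' = A_{k-1} f_{k-1} + B_{k+1} f_{k+1} - (A_k + B_k) f_k, a birth-death
    chain whose rates depend on f.
    - The l1-norm N of the negative part satisfies N(s) <= N(t) + (s - t)(c N(t) + o(1))
      for s slightly above t, because A_k, B_k >= -C_K N; a Gronwall argument
      gives N = 0, so f >= 0.  The sum over k of Q(f)(k) telescopes, so the mass m
      is constant and 0 <= A_k, B_k <= C_K m.
    - If f_k(t) = 0 with t > 0, then t is an interior minimum of f_k, hence Q(f)(k) = 0
      at time t and both neighbours vanish at the same time; thus f(t) = 0,
      contradicting m > 0.
    - If K >= c_K, then g_k = exp(2 C_K m t) f_k satisfies g_{k+-1}' >= c_K m g_k.
      Integrating over the n-th time step, of length t_0 a_n / sigma, gains a factor
      c_K m t_0 a_n / sigma >= c_K m / (2 C_K + sigma / (t_0 a_n)). *)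

Require Import Defs.
From HB Require Import structures.
From mathcomp Require Import all_boot all_order all_algebra.
From mathcomp Require Import all_classical all_reals all_analysis.
From mathcomp Require Import finmap lra.

Set Implicit Arguments.
Unset Strict Implicit.
Unset Printing Implicit Defensive.

Import Order.TTheory GRing.Theory Num.Theory.
Import numFieldNormedType.Exports.
Local Open Scope classical_set_scope.
Local Open Scope ring_scope.

(** * Sums over the integers *)

Lemma ell1_le (R : realType) (g h : int -> R) :
  ell1 g -> (forall k, `|h k| <= `|g k|) -> ell1 h.
Proof.
move=> g1 hg; apply: le_integrable g1 => //.
by move=> k _; rewrite /= lee_fin.
Qed.

Lemma ell1D (R : realType) (g h : int -> R) :
  ell1 g -> ell1 h -> ell1 (fun k => g k + h k).
Proof. by move=> g1 h1; exact: (integrableD measurableT g1 h1). Qed.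

Lemma ell1Z (R : realType) (c : R) (g : int -> R) :
  ell1 g -> ell1 (fun k => c * g k).
Proof. by move=> g1; exact: (integrableZl measurableT c g1). Qed.

Lemma ell1B (R : realType) (g h : int -> R) :
  ell1 g -> ell1 h -> ell1 (fun k => g k - h k).
Proof. by move=> g1 h1; exact: (integrableB measurableT g1 h1). Qed.

Lemma ell1_norm (R : realType) (g : int -> R) :
  ell1 g -> ell1 (fun k => `|g k|).
Proof. by move=> g1; apply: (ell1_le g1) => k; rewrite normr_id. Qed.

Lemma ell1M (R : realType) (C : R) (b g : int -> R) :
  (forall k, `|b k| <= C) -> ell1 g -> ell1 (fun k => b k * g k).
Proof.
move=> bC g1; apply: (ell1_le (ell1Z C g1)) => k.
rewrite !normrM ler_wpM2r// (le_trans (bC k))//.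
exact: ler_norm.
Qed.

(** A translation is a bijection, so it preserves finiteness and cardinality. All reindexing of
    sums, and hence the telescoping, rests on this. *)
Lemma counting_shift (R : realType) (c : int) :
  pushforward (@counting int R) (fun k => k + c) = counting.
Proof.
apply/funext => A; rewrite /pushforward /counting.
have E : (fun k => k + c) @` ((fun k => k + c) @^-1` A) = A.
  apply/seteqP; split => [x [y Ay <-]//|x Ax].
  by exists (x - c); rewrite /= subrK.
have fE : finite_set ((fun k => k + c) @^-1` A) <-> finite_set A.
  split => [|fA]; first by move=> /(finite_image (fun k => k + c)); rewrite E.
  have -> : (fun k => k + c) @^-1` A = (fun k => k - c) @` A.
    apply/seteqP; split => [x Ax|x [y Ay <-]]; last by rewrite /= subrK.
    by exists (x + c) => //; rewrite addrK.
  exact: finite_image.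
case: ifPn => /asboolP fA; case: ifPn => /asboolP fB //; try tauto.
rewrite -[in RHS]E fset_set_image// card_imfset//.
exact: addIr.
Qed.

Lemma ell1_shift (R : realType) (c : int) (g : int -> R) :
  ell1 g -> ell1 (fun k => g (k + c)).
Proof.
move=> g1; apply/integrableP; split=> //.
have /integrableP[_] := g1.
by rewrite -{1}(counting_shift R c) ge0_integral_pushforward.
Qed.

Lemma sumZ_shift (R : realType) (c : int) (g : int -> R) :
  ell1 g -> sumZ (fun k => g (k + c)) = sumZ g.
Proof.
move=> g1; rewrite /sumZ /Rintegral; congr fine.
transitivity (\int[pushforward (@counting int R) (fun k => k + c)%R]_y (EFin \o g) y)%E.
  by rewrite integral_pushforward//; exact: ell1_shift g1.
by rewrite counting_shift.
Qed.

Lemma sumZD (R : realType) (g h : int -> R) :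
  ell1 g -> ell1 h -> sumZ (fun k => g k + h k) = sumZ g + sumZ h.
Proof. by move=> g1 h1; exact: (RintegralD measurableT g1 h1). Qed.

Lemma sumZB (R : realType) (g h : int -> R) :
  ell1 g -> ell1 h -> sumZ (fun k => g k - h k) = sumZ g - sumZ h.
Proof. by move=> g1 h1; exact: (RintegralB measurableT g1 h1). Qed.

Lemma sumZZ (R : realType) (c : R) (g : int -> R) :
  ell1 g -> sumZ (fun k => c * g k) = c * sumZ g.
Proof. by move=> g1; exact: (RintegralZl c measurableT g1). Qed.

Lemma le_sumZ (R : realType) (g h : int -> R) :
  ell1 g -> ell1 h -> (forall k, g k <= h k) -> sumZ g <= sumZ h.
Proof. by move=> g1 h1 gh; exact: (le_Rintegral measurableT g1 h1). Qed.

Lemma sumZ_ge0 (R : realType) (g : int -> R) :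
  (forall k, 0 <= g k) -> 0 <= sumZ g.
Proof. by move=> g0; apply: Rintegral_ge0. Qed.

Lemma norm_sumZ_le (R : realType) (g : int -> R) :
  ell1 g -> `|sumZ g| <= norm1 g.
Proof. by move=> g1; exact: (le_normr_Rintegral measurableT g1). Qed.

Lemma le_term_sumZ (R : realType) (g : int -> R) (k : int) :
  ell1 g -> (forall k, 0 <= g k) -> g k <= sumZ g.
Proof.
move=> g1 g0.
have -> : g k = sumZ (g \_ [set k]).
  rewrite /sumZ -Rintegral_mkcond (@eq_Rintegral _ _ _ _ _ (cst (g k))).
    rewrite Rintegral_cst//= /counting asboolT ?finite_set1//.
    by rewrite fset_set1 cardfs1 mulr1.
  by move=> j /set_mem ->.
have gk j : 0 <= (g \_ [set k]) j <= g j.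
  by rewrite patchE; case: ifP => _; rewrite ?lexx ?g0.
apply: le_sumZ => //; last by move=> j; case/andP: (gk j).
apply: (ell1_le g1) => j; have /andP[h0 h1] := gk j.
by rewrite !ger0_norm// (le_trans h0 h1).
Qed.

Lemma norm_le_norm1 (R : realType) (g : int -> R) (k : int) :
  ell1 g -> `|g k| <= norm1 g.
Proof.
by move=> g1; apply: (@le_term_sumZ _ (fun k => `|g k|)) => //; exact: ell1_norm.
Qed.

Lemma eq_sumZ (R : realType) (g h : int -> R) : g =1 h -> sumZ g = sumZ h.
Proof. by move=> /funext ->. Qed.

Lemma norm1_ge0 (R : realType) (g : int -> R) : 0 <= norm1 g.
Proof. exact: sumZ_ge0. Qed.

Lemma norm1_le_add (R : realType) (g h w : int -> R) :
  ell1 g -> ell1 h -> ell1 w -> (forall k, `|w k| <= `|g k| + `|h k|) ->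
  norm1 w <= norm1 g + norm1 h.
Proof.
move=> /ell1_norm g1 /ell1_norm h1 /ell1_norm w1 H.
by rewrite /norm1 -sumZD//; apply: le_sumZ => //; exact: ell1D.
Qed.

Lemma norm1Z (R : realType) (c : R) (g : int -> R) : ell1 g ->
  norm1 (fun k => c * g k) = `|c| * norm1 g.
Proof.
move=> /ell1_norm g1; rewrite /norm1 -sumZZ//.
by apply: eq_sumZ => k; rewrite normrM.
Qed.

(** * Calculus on the half-line *)

Lemma is_derive_eps (R : realType) (h : R -> R) (t dh : R) : 0 < t ->
  (forall e, 0 < e -> exists2 d, 0 < d & forall s, 0 <= s -> `|s - t| < d ->
     `|h s - h t - (s - t) * dh| <= e * `|s - t|) ->
  is_derive t 1 h dh.
Proof.
move=> t0 H.
have L : x^-1 *: ((h \o shift t) (x *: 1) - h t) @[x --> 0^'] --> dh.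
  apply/cvgrPdist_le => e e0.
  have [d d0 dP] := H e e0.
  (* The hypothesis speaks of nonnegative times only; increments smaller than [t] stay in that
     range. *)
  have m0 : 0 < Num.min d t by rewrite lt_min d0.
  apply/nbhs_ballP; exists (Num.min d t) => //= x.
  rewrite /ball/= sub0r normrN lt_min => /andP[xd xt] x0.
  have xt0 : 0 <= x + t.
    by move: xt; rewrite ltr_norml => /andP[? _]; lra.
  have := dP (x + t) xt0; rewrite addrK => /(_ xd).
  rewrite /= [x *: 1]mulr1.
  rewrite (_ : _ - _ - _ = x * (x^-1 *: (h (x + t) - h t) - dh)).
    by rewrite normrM mulrC distrC ler_pM2r// normr_gt0.
  by rewrite mulrBr [_ *: _]/(_ * _) mulVKf.
split.
  by apply/cvg_ex; exists dh.
exact/cvg_lim.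
Qed.

Lemma within_continuous_eps (R : realType) (h : R -> R) (a b : R) : 0 <= a ->
  (forall t e, 0 <= t -> 0 < e -> exists2 d, 0 < d &
     forall s, 0 <= s -> `|s - t| < d -> `|h s - h t| <= e) ->
  {within `[a, b], continuous h}.
Proof.
move=> a0 H; apply/subspace_continuousP => t /=; rewrite in_itv/= => /andP[at_ tb].
apply/cvgrPdist_le => e e0.
have [d d0 dP] := H t e (le_trans a0 at_) e0.
apply/nbhs_ballP; exists d => //= s.
rewrite /ball/= distrC => std; rewrite in_itv/= => /andP[as_ _].
by rewrite distrC dP// (le_trans a0).
Qed.

Lemma ge0_derive_le (R : realType) (h dh : R -> R) (a b : R) : a <= b ->
  {within `[a, b], continuous h} ->
  (forall t, a < t < b -> is_derive t 1 h (dh t)) ->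
  (forall t, a < t < b -> 0 <= dh t) -> h a <= h b.
Proof.
move=> ab ch hd d0.
move: ab; rewrite le_eqVlt => /predU1P[->//|ab].
have hd' x : x \in `]a, b[%R -> is_derive x 1 h (dh x).
  by rewrite in_itv/= => /hd.
have [c cab E] := MVT ab hd' ch.
by rewrite -subr_ge0 E mulr_ge0 ?d0 ?subr_ge0 ?(ltW ab)// -in_itv.
Qed.

(** The sum of negative parts need not be differentiable, so a one-sided bound on its increments
    replaces a derivative. [N] is compared with an exponential [psi] starting slightly above [N a]:
    the last point where [N <= psi] cannot lie before [t], since the one-sided bound carries the
    inequality a little further. *)
Lemma dini_gronwall (R : realType) (N : R -> R) (a b c : R) : 0 <= a -> 0 <= c ->
  (forall t, 0 <= N t) ->
  (forall t e, 0 <= t -> 0 < e -> exists2 d, 0 < d &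
     forall s, 0 <= s -> `|s - t| < d -> `|N s - N t| <= e) ->
  (forall t e, a <= t < b -> 0 < e -> exists2 d, 0 < d &
     forall s, t < s < t + d -> N s <= N t + (s - t) * (c * N t + e)) ->
  forall t, a <= t <= b -> N t <= N a * expR ((c + 1) * (t - a)).
Proof.
move=> a0 c0 N0 cN dN t /andP[at_ tb].
apply/ler_addgt0Pr => e0 e0_gt0.
(* This [eta] makes [psi t] exceed the claimed bound by exactly [e0]. *)
pose eta := e0 / expR ((c + 1) * (t - a)).
have eta0 : 0 < eta by rewrite divr_gt0// expR_gt0.
(* The rate [c + 1] beats [c] by enough to absorb the error [e] at the last
   point [z] where [N <= psi]. *)
pose psi s := (N a + eta) * expR ((c + 1) * (s - a)).
have psi0 s : 0 < psi s by rewrite mulr_gt0 ?expR_gt0// ltr_wpDl.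
suff : N t <= psi t.
  by rewrite /psi mulrDl divfK// gt_eqF// expR_gt0.
rewrite leNgt; apply/negP => Nt.
pose E := [set s | a <= s <= t /\ N s <= psi s].
have Ea : E a.
  split; first by rewrite lexx.
  by rewrite /psi subrr mulr0 expR0 mulr1 lerDl ltW.
have hsE : has_sup E.
  by split; [exists a|exists t => s [/andP[_ ?] _]].
pose z := sup E.
have az : a <= z by apply: ub_le_sup => //; case: hsE.
have zt : z <= t by apply: ge_sup; [exists a|move=> s [/andP[_ ?] _]].
have cpsi : forall e, 0 < e -> exists2 d, 0 < d &
    forall s, `|s - z| < d -> `|psi s - psi z| <= e.
  move=> e e_gt0.
  have : {for z, continuous psi}.
    apply: continuousM; first exact: cst_continuous.
    apply: (@continuous_comp _ _ _ (fun s => (c + 1) * (s - a)) expR).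
      apply: continuousM; first exact: cst_continuous.
      by apply: continuousB => //; exact: cst_continuous.
    exact: continuous_expR.
  move=> /cvgrPdist_le/(_ e e_gt0)/nbhs_ballP[d /= d0 dP].
  by exists d => // s sz; rewrite distrC; apply: dP; rewrite /ball/= distrC.
have Nz : N z <= psi z.
  apply/ler_addgt0Pr => e e_gt0.
  have e2 : 0 < e / 2 by rewrite divr_gt0.
  have [d1 d10 d1P] := cN z _ (le_trans a0 az) e2.
  have [d2 d20 d2P] := cpsi _ e2.
  have d12 : 0 < Num.min d1 d2 by rewrite lt_min d10.
  have [s Es] := sup_adherent d12 hsE.
  rewrite -/z => zs.
  have sz : s <= z by apply: ub_le_sup => //; case: hsE.
  have szd : `|s - z| < Num.min d1 d2 by rewrite distrC ger0_norm; lra.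
  case: Es => /andP[as_ _] Ns.
  have := d1P s (le_trans a0 as_); have := d2P s.
  move: szd; rewrite lt_min => /andP[-> ->] /(_ isT) + /(_ isT).
  by rewrite !ler_norml => /andP[? ?] /andP[? ?]; lra.
have zt' : z < t.
  by rewrite lt_neqAle zt andbT; apply/eqP => ztE; move: Nt; rewrite -ztE ltNge Nz.
(* With error [psi z], the new value is at most [psi z * (1 + (c + 1) * (s - z))], and
   [1 + x <= expR x] bounds this by [psi s]. *)
have [|d d0 dP] := dN z (psi z) _ (psi0 z).
  by rewrite az (lt_le_trans zt').
pose s := Num.min (z + d / 2) t.
have zs : z < s by rewrite lt_min zt' andbT ltrDl divr_gt0.
have sd : s < z + d by rewrite gt_min; apply/orP; left; lra.
have st : s <= t by rewrite ge_min lexx orbT.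
have Es : E s.
  split; first by rewrite st (le_trans az) ?ltW.
  apply: (le_trans (dP s _)); first by rewrite zs sd.
  have -> : psi s = psi z * expR ((c + 1) * (s - z)).
    by rewrite /psi -mulrA -expRD; congr (_ * expR _); lra.
  apply: (@le_trans _ _ (psi z * (1 + (c + 1) * (s - z)))); last first.
    by rewrite ler_pM2l// expR_ge1Dx.
  have : 0 <= (s - z) * c * (psi z - N z).
    by rewrite !mulr_ge0 ?subr_ge0 ?(ltW zs).
  by lra.
have : s <= z by apply: ub_le_sup => //; case: hsE.
by rewrite leNgt zs.
Qed.

(** * Differentiable curves in ell1 *)

Lemma derivative_ell1_eps (R : realType) (u v : R -> int -> R) (t e : R) :
  (forall s, 0 <= s -> ell1 (u s) /\ ell1 (v s)) -> derivative_ell1 u v ->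
  0 <= t -> 0 < e ->
  exists2 d, 0 < d & forall s, 0 <= s -> `|s - t| < d ->
    norm1 (fun k => u s k - u t k - (s - t) * v t k) <= e * `|s - t|.
Proof.
move=> uv1 uv t0 e0.
have /cvgrPdist_le/(_ _ e0) := uv t t0.
move=> /nbhs_ballP[d /= d0 dP]; exists d => // s s0 std.
(* The punctured limit says nothing at [s = t], where both sides vanish. *)
have [->|st] := eqVneq s t.
  rewrite subrr normr0 mulr0 (_ : (fun _ => _) = (fun=> 0)).
    by rewrite /norm1 normr0 /sumZ Rintegral_cst// mul0r.
  by apply/funext => k; rewrite subrr mul0r subr0.
have st0 : s - t != 0 by rewrite subr_eq0.
have := dP s; rewrite /ball/= distrC => /(_ std st).
rewrite in_itv/= s0 => /(_ isT).
have [us1 _] := uv1 s s0; have [ut1 vt1] := uv1 t t0.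
rewrite sub0r normrN ger0_norm; last exact: sumZ_ge0.
move=> H.
rewrite (_ : norm1 _ =
    `|s - t| * norm1 (fun k => (s - t)^-1 * (u s k - u t k) - v t k)).
  by rewrite mulrC ler_wpM2r.
rewrite /norm1 -sumZZ; last by apply/ell1_norm/ell1B => //; apply/ell1Z/ell1B.
congr sumZ; apply/funext => k.
by rewrite -normrM mulrBr mulVKf.
Qed.

(** The derivative estimate with error [1] bounds the increment of the curve near [t] by
    [(norm1 (v t) + 1) * |s - t|]. Allowing nonlinear [L] covers the norm and the sum of negative
    parts. *)
Lemma lipschitz_ell1_curve (R : realType) (u v : R -> int -> R)
    (L : (int -> R) -> R) :
  (forall s, 0 <= s -> ell1 (u s) /\ ell1 (v s)) -> derivative_ell1 u v ->
  (forall g h, ell1 g -> ell1 h -> `|L g - L h| <= norm1 (fun k => g k - h k)) ->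
  forall t e, 0 <= t -> 0 < e -> exists2 d, 0 < d &
     forall s, 0 <= s -> `|s - t| < d -> `|L (u s) - L (u t)| <= e.
Proof.
move=> uv1 uv Llip t e t0 e0.
have [d d0 dP] := derivative_ell1_eps uv1 uv t0 ltr01.
have [ut1 vt1] := uv1 t t0.
have V0 := norm1_ge0 (v t).
have V1 : 0 < norm1 (v t) + 1 by rewrite ltr_wpDl.
exists (Num.min d (e / (norm1 (v t) + 1))); first by rewrite lt_min d0 divr_gt0.
move=> s s0; rewrite lt_min => /andP[sd].
rewrite ltr_pdivlMr// => se.
have [us1 _] := uv1 s s0.
apply: (le_trans (Llip _ _ us1 ut1)).
apply: (@le_trans _ _ (norm1 (fun k => u s k - u t k - (s - t) * v t k)
    + norm1 (fun k => (s - t) * v t k))).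
  apply: norm1_le_add => [||| k].
  - by apply: ell1B; [exact: ell1B|exact: ell1Z].
  - exact: ell1Z.
  - exact: ell1B.
  - by rewrite -[X in `|X| <= _](subrK ((s - t) * v t k)) ler_normD.
rewrite norm1Z//; have := dP s s0 sd; lra.
Qed.

(** A bounded linear functional commutes with the derivative in [ell1]. The cases of interest are
    the total sum and the evaluation at one site. *)
Lemma linear_ell1_curve (R : realType) (u v : R -> int -> R)
    (L : (int -> R) -> R) :
  (forall s, 0 <= s -> ell1 (u s) /\ ell1 (v s)) -> derivative_ell1 u v ->
  (forall g h, ell1 g -> ell1 h -> L (fun k => g k - h k) = L g - L h) ->
  (forall c g, ell1 g -> L (fun k => c * g k) = c * L g) ->
  (forall g, ell1 g -> `|L g| <= norm1 g) ->
  (forall t : R, 0 < t -> is_derive t 1 (fun s => L (u s)) (L (v t))) /\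
  (forall a b : R, 0 <= a -> {within `[a, b], continuous (fun s => L (u s))}).
Proof.
move=> uv1 uv LB LZ Lle; split=> [t t0|a b a0].
  apply: is_derive_eps => // e e0.
  have [d d0 dP] := derivative_ell1_eps uv1 uv (ltW t0) e0.
  exists d => // s s0 sd; apply: le_trans (dP s s0 sd).
  have [us1 _] := uv1 s s0; have [ut1 vt1] := uv1 t (ltW t0).
  have w1 : ell1 (fun k => (s - t) * v t k) by exact: ell1Z.
  rewrite -LZ// -LB// -LB//; last exact: ell1B.
  by apply: Lle; apply: ell1B => //; exact: ell1B.
apply: within_continuous_eps => //; apply: (lipschitz_ell1_curve uv1 uv) => g h g1 h1.
by rewrite -LB//; apply: Lle; exact: ell1B.
Qed.

(** * The collision operator *)

Definition rise_rate (R : realType) (K : int -> int -> R) (g : int -> R) (k : int) :=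
  sumZ (fun l => K l k * g l).

(** This is [B_k], and [rise_rate] is [A_k]. Written with the transposed kernel, it inherits every
    estimate on rise rates after the arguments of [K] are swapped. *)
Definition fall_rate (R : realType) (K : int -> int -> R) (g : int -> R) (k : int) :=
  rise_rate (fun l k => K k l) g k.

(** Factors independent of [l] leave the four sums, and a shift of [l] by one turns two of these
    into fall rates. *)
Lemma collisionE (R : realType) (K : int -> int -> R) (C : R) (g : int -> R) (k : int) :
  (forall k l, `|K k l| <= C) -> ell1 g ->
  collision K g k = rise_rate K g (k - 1) * g (k - 1) - fall_rate K g k * g k
    - rise_rate K g k * g k + fall_rate K g (k + 1) * g (k + 1).
Proof.
move=> KC g1.
have K1 j : ell1 (fun l => K l j * g l) by exact: (@ell1M _ C (fun l => K l j)).
have K2 j : ell1 (fun l => K j l * g l) by exact: (@ell1M _ C (K j)).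
have S2 j : ell1 (fun l => K j (l - 1) * g (l - 1)) by exact: (ell1_shift (-1) (K2 j)).
have F2 j : fall_rate K g j = sumZ (fun l => K j (l - 1) * g (l - 1)).
  exact/esym/(sumZ_shift (-1) (K2 j)).
rewrite !F2 /rise_rate.
rewrite /collision /collision2.
rewrite [LHS](_ : _ = sumZ (fun l => g (k - 1) * (K l (k - 1) * g l)
  - g k * (K k (l - 1) * g (l - 1)) - g k * (K l k * g l)
  + g (k + 1) * (K (k + 1) (l - 1) * g (l - 1)))); last first.
  by apply: eq_sumZ => l; lra.
have Z1 := fun c j => ell1Z c (K1 j).
have Z2 := fun c j => ell1Z c (S2 j).
rewrite sumZD ?sumZB ?sumZZ//; first lra.
all: by do ?apply: ell1B; apply: Z1 || apply: Z2.
Qed.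

Lemma rise_rate_le (R : realType) (K : int -> int -> R) (C : R) (g : int -> R) k :
  (forall k l, `|K k l| <= C) -> ell1 g -> `|rise_rate K g k| <= C * norm1 g.
Proof.
move=> KC g1.
have Kg1 : ell1 (fun l => K l k * g l) by exact: (@ell1M _ C (fun l => K l k)).
apply: (le_trans (norm_sumZ_le Kg1)).
rewrite /norm1 -sumZZ; last exact: ell1_norm.
apply: le_sumZ; [exact: ell1_norm|exact/ell1Z/ell1_norm|move=> l].
by rewrite normrM ler_wpM2r.
Qed.

Lemma ell1_rate (R : realType) (K : int -> int -> R) (C : R) (g h : int -> R) :
  (forall k l, `|K k l| <= C) -> ell1 g -> ell1 h ->
  ell1 (fun k => rise_rate K g k * h k).
Proof.
move=> KC g1 h1; apply: (@ell1M _ (C * norm1 g)) => // k.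
exact: rise_rate_le.
Qed.

(** Each gain term is a loss term shifted by one site, so the four sums cancel in pairs. *)
Lemma mass_collision (R : realType) (K : int -> int -> R) (C : R) (g : int -> R) :
  (forall k l, `|K k l| <= C) -> ell1 g -> mass (collision K g) = 0.
Proof.
move=> KC g1.
have A1 := ell1_rate KC g1 g1.
have B1 := ell1_rate (fun k l => KC l k) g1 g1.
have As := ell1_shift (-1) A1.
have Bs := ell1_shift 1 B1.
rewrite /mass (eq_sumZ (fun k => collisionE k KC g1)).
rewrite sumZD ?sumZB//; last first.
- by do 2 apply: ell1B => //.
- exact: ell1B.
rewrite (sumZ_shift (-1) A1) (sumZ_shift 1 B1); lra.
Qed.

Lemma ell1_negpart (R : realType) (g : int -> R) :
  ell1 g -> ell1 (fun k => Num.max (- g k) 0).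
Proof.
move=> g1; apply: (ell1_le g1) => k.
by case: (lerP (- g k) 0) => h; rewrite ?normr0// normrN.
Qed.

Lemma sumZ_negpart_lipschitz (R : realType) (g h : int -> R) : ell1 g -> ell1 h ->
  `|sumZ (fun k => Num.max (- g k) 0) - sumZ (fun k => Num.max (- h k) 0)|
    <= norm1 (fun k => g k - h k).
Proof.
move=> g1 h1.
rewrite -sumZB; [|exact: ell1_negpart..].
have w1 : ell1 (fun k => Num.max (- g k) 0 - Num.max (- h k) 0).
  by apply: ell1B; exact: ell1_negpart.
apply: (le_trans (norm_sumZ_le w1)).
apply: le_sumZ; [exact: ell1_norm|exact/ell1_norm/ell1B|move=> k].
case: (lerP (- g k) 0) => ?; case: (lerP (- h k) 0) => ?; rewrite ler_norml;
  case: (ler0P (g k - h k)) => ?; apply/andP; split; lra.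
Qed.

(* [x] stands for [g k], [y] and [z] for its neighbours, [a], [b], [c], [d] for
   the rates, [P] and [Q] for [C] times the l1-norms of [g] and of its negative
   part. Gain terms can only be negative through a negative rate, which is at
   least [- Q], or through a negative neighbour. *)
Lemma negpart_euler_step (R : realType) (P Q h x y z a b c d : R) :
  0 <= h -> h * (2 * P) <= 1 -> 0 <= Q ->
  `|a| <= P -> `|b| <= P -> - Q <= c <= P -> - Q <= d <= P ->
  Num.max (- (x + h * (c * y - b * x - a * x + d * z))) 0 <=
    Num.max (- x) 0
    + h * (2 * P * Num.max (- x) 0 + (Q * `|y| + P * Num.max (- y) 0)
           + (Q * `|z| + P * Num.max (- z) 0)).
Proof.
move=> h0 hP Q0 aP bP cP dP.
have E w r : - Q <= r <= P -> - (r * w) <= Q * `|w| + P * Num.max (- w) 0.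
  move=> /andP[Qr rP].
  case: (ler0P w) => w0; case: (lerP (- w) 0) => w1; nra.
have Ec := E y c cP; have Ed := E z d dP.
have P0 : 0 <= P by apply: le_trans aP.
(* The restriction on [h] keeps [1 - h * (a + b)] between [0] and [1 + h * (2 * P)], so the losses
   cannot change the sign of [x]. *)
have E2 : - (x - h * (a + b) * x) <= Num.max (- x) 0 + h * (2 * P * Num.max (- x) 0).
  move: aP bP; rewrite !ler_norml => /andP[a1 a2] /andP[b1 b2].
  have L1 : h * (a + b) <= h * (2 * P) by rewrite ler_wpM2l//; lra.
  have L2 : - (h * (2 * P)) <= h * (a + b) by rewrite -mulrN ler_wpM2l//; lra.
  case: (lerP (- x) 0) => x0; nra.
have pos w : 0 <= Num.max (- w) 0 :> R by rewrite le_max lexx orbT.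
have := ler_wpM2l h0 Ec; have := ler_wpM2l h0 Ed => H1 H2.
rewrite ge_max; apply/andP; split; first lra.
by rewrite !(addr_ge0, mulr_ge0).
Qed.

(** Only the negative part of [g] contributes negatively, with weight at most [C]. A negative rate
    is thus controlled by the very quantity to which Gronwall is applied. *)
Lemma rise_rate_ge_negpart (R : realType) (K : int -> int -> R) (C : R) (g : int -> R) k :
  (forall k l, 0 <= K k l) -> (forall k l, K k l <= C) -> ell1 g ->
  - (C * sumZ (fun k => Num.max (- g k) 0)) <= rise_rate K g k.
Proof.
move=> K0 KC g1.
have Kg1 : ell1 (fun l => K l k * g l).
  by apply: (@ell1M _ C (fun l => K l k)) => // l; rewrite ger0_norm.
have n1 := ell1_negpart g1.
rewrite -mulNr -sumZZ//; apply: le_sumZ => //; first exact: ell1Z.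
move=> l; have := K0 l k; have := KC l k.
by case: (lerP (- g l) 0) => ? ? ?; nra.
Qed.

(** One explicit Euler step, summed over all sites. Of the factor [6], the losses at a site account
    for [2] and each of its neighbours for [2]. *)
Lemma negpart_collision_step (R : realType) (K : int -> int -> R) (C h : R)
    (g : int -> R) :
  (forall k l, 0 <= K k l) -> (forall k l, K k l <= C) -> ell1 g ->
  0 <= h -> h * (2 * (C * norm1 g)) <= 1 ->
  sumZ (fun k => Num.max (- (g k + h * collision K g k)) 0) <=
    sumZ (fun k => Num.max (- g k) 0)
    + h * (6 * (C * norm1 g) * sumZ (fun k => Num.max (- g k) 0)).
Proof.
move=> K0 KC g1 h0 hP.
have KC' k l : `|K k l| <= C by rewrite ger0_norm.
have C0 : 0 <= C by apply: le_trans (KC 0 0).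
set N := sumZ (fun k => Num.max (- g k) 0).
set P := C * norm1 g.
have N0 : 0 <= N by apply: sumZ_ge0 => k; rewrite le_max lexx orbT.
have n1 := ell1_negpart g1.
have a1 := ell1_norm g1.
(* [w j] bounds the negative contribution of site [j] to one neighbour; its two terms add up to
   [P * N] each. *)
pose w k := (C * N) * `|g k| + P * Num.max (- g k) 0.
have w1 : ell1 w by apply: ell1D; exact: ell1Z.
have wE : sumZ w = 2 * P * N.
  rewrite sumZD ?sumZZ//; [|exact: ell1Z..].
  by rewrite -/N -/(norm1 g) /P; lra.
pose r k := Num.max (- g k) 0
    + h * (2 * P * Num.max (- g k) 0 + w (k - 1) + w (k + 1)).
have wm := ell1_shift (-1) w1; have wp := ell1_shift 1 w1.
have r0 : ell1 (fun k => 2 * P * Num.max (- g k) 0) by exact: ell1Z.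
have r1 : ell1 (fun k => 2 * P * Num.max (- g k) 0 + w (k - 1)) by exact: ell1D.
have r2 : ell1 (fun k => 2 * P * Num.max (- g k) 0 + w (k - 1) + w (k + 1)).
  exact: ell1D.
have rE : sumZ r = N + h * (6 * P * N).
  rewrite sumZD//; last exact: ell1Z.
  rewrite sumZZ// sumZD// sumZD// sumZZ// (sumZ_shift (-1) w1) (sumZ_shift 1 w1) wE.
  by rewrite -/N; lra.
rewrite -rE; apply: le_sumZ.
- apply/ell1_negpart/ell1D => //; apply: ell1Z.
  have A1 := ell1_rate KC' g1 g1.
  have B1 := ell1_rate (fun k l => KC' l k) g1 g1.
  have As := ell1_shift (-1) A1; have Bs := ell1_shift 1 B1.
  rewrite (funext (fun k => collisionE k KC' g1)).
  by apply: ell1D => //; do 2 apply: ell1B => //.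
- by apply: ell1D => //; exact: ell1Z.
move=> k; rewrite (collisionE k KC' g1) /r /w.
have A j : `|rise_rate K g j| <= P by exact: rise_rate_le.
have B j : `|fall_rate K g j| <= P by exact: rise_rate_le (fun k l => KC' l k) g1.
have A' j : - (C * N) <= rise_rate K g j <= P.
  by rewrite rise_rate_ge_negpart//=; apply: le_trans (A j); exact: ler_norm.
have B' j : - (C * N) <= fall_rate K g j <= P.
  apply/andP; split.
    exact: rise_rate_ge_negpart (fun k l => K0 l k) (fun k l => KC l k) g1.
  by apply: le_trans (B j); exact: ler_norm.
by apply: negpart_euler_step => //; rewrite mulr_ge0.
Qed.

(** * Nonnegativity and conservation of mass *)

(** Near [t] the solution differs from an Euler step by [o(s - t)] in norm. As the sum of negative
    parts is 1-Lipschitz, the Euler estimate gives the one-sided bound required by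
    [dini_gronwall]. *)
Lemma solution_ge0 (R : realType) (K : int -> int -> R) (C : R) (f0 : int -> R)
    (f : R -> int -> R) :
  (forall k l, 0 <= K k l) -> (forall k l, K k l <= C) ->
  (forall k, 0 <= f0 k) -> is_solution K f0 f ->
  forall t k, 0 <= t -> 0 <= f t k.
Proof.
move=> K0 KC f00 [v [[uv1 uv _] fQ fE]] T k T0.
have C0 : 0 <= C by apply: le_trans (KC 0 0).
pose N t := sumZ (fun k => Num.max (- f t k) 0).
have N0 t : 0 <= N t by apply: sumZ_ge0 => j; rewrite le_max lexx orbT.
have cN : forall t e, 0 <= t -> 0 < e -> exists2 d, 0 < d &
     forall s, 0 <= s -> `|s - t| < d -> `|N s - N t| <= e.
  exact: (lipschitz_ell1_curve uv1 uv (@sumZ_negpart_lipschitz R)).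
have NN0 : N 0 = 0.
  rewrite /N (_ : (fun _ => _) = fun=> 0) ?/sumZ ?Rintegral_cst ?mul0r//.
  by apply/funext => j; rewrite fE max_r// oppr_le0.
(* Without nonnegativity the mass does not control the norm; continuity on a compact interval
   supplies the bound. *)
have [M M0 MP] : exists2 M, 0 <= M & forall t, 0 <= t <= T -> norm1 (f t) <= M.
  have [|c _ cP] := @EVT_max R (fun t => norm1 (f t)) 0 T T0.
    apply: within_continuous_eps => //.
    apply: (lipschitz_ell1_curve uv1 uv) => g h g1 h1.
    rewrite /norm1 -sumZB; [|exact: ell1_norm..].
    have w1 : ell1 (fun k => `|g k| - `|h k|) by apply: ell1B; exact: ell1_norm.
    apply: (le_trans (norm_sumZ_le w1)).
    apply: le_sumZ; [exact: ell1_norm|exact/ell1_norm/ell1B|move=> j].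
    exact: ler_dist_dist.
  by exists (norm1 (f c)) => [|t tT]; [exact: norm1_ge0|apply: cP; rewrite in_itv].
pose c := 6 * (C * M).
have c0 : 0 <= c by rewrite !mulr_ge0.
(* The equation is given for positive times only, so [t = 0] is excluded. *)
have dN t e : 0 < t < T -> 0 < e -> exists2 d, 0 < d &
    forall s, t < s < t + d -> N s <= N t + (s - t) * (c * N t + e).
  move=> /andP[t0 tT] e0.
  have [d d0 dP] := derivative_ell1_eps uv1 uv (ltW t0) e0.
  have CM0 : 0 < 2 * (C * M) + 1 by rewrite ltr_wpDl// !mulr_ge0.
  exists (Num.min d (2 * (C * M) + 1)^-1); first by rewrite lt_min d0 invr_gt0.
  move=> s /andP[ts]; rewrite -ltrBlDl lt_min => /andP[sd].
  rewrite -[_^-1]mul1r ltr_pdivlMr// => sM.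
  have st0 : 0 < s - t by rewrite subr_gt0.
  have s0 : 0 <= s by apply/ltW/(lt_trans t0).
  have [us1 _] := uv1 s s0; have [ut1 vt1] := uv1 t (ltW t0).
  have Mt : C * norm1 (f t) <= C * M by rewrite ler_wpM2l// MP// !ltW.
  have stP : (s - t) * (2 * (C * norm1 (f t))) <= 1 by nra.
  have := negpart_collision_step K0 KC ut1 (ltW st0) stP.
  rewrite -/(N t) => H.
  pose g j := f t j + (s - t) * v t j.
  have g1 : ell1 g by apply: ell1D => //; exact: ell1Z.
  have := sumZ_negpart_lipschitz us1 g1.
  rewrite -/(N s) => /ler_normlP[_].
  rewrite (_ : (fun k => f s k - g k) =
    fun j => f s j - f t j - (s - t) * v t j); last first.
    by apply/funext => j; rewrite /g opprD addrA.
  rewrite (_ : sumZ _ = sumZ (fun k =>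
    Num.max (- (f t k + (s - t) * collision K (f t) k)) 0)); last first.
    by apply: eq_sumZ => j; rewrite /g fQ.
  have := dP s s0; rewrite gtr0_norm// => /(_ sd) => H1 H2.
  have : (s - t) * (6 * (C * norm1 (f t)) * N t) <= (s - t) * (c * N t).
    by rewrite ler_wpM2l ?(ltW st0)// ler_wpM2r// /c ler_wpM2l.
  lra.
have NT : N T = 0.
  apply/eqP; rewrite eq_le N0 andbT.
  apply/ler_addgt0Pr => e e0; rewrite add0r.
  have := T0; rewrite le_eqVlt => /predU1P[<-|T_gt0]; first by rewrite NN0 ltW.
  have E0 : 0 < expR ((c + 1) * T) by exact: expR_gt0.
  have [d d0 dP] := cN 0 (e / expR ((c + 1) * T)) (lexx 0) (divr_gt0 e0 E0).
  (* Gronwall starts at a positive time [a], where continuity at [0] makes [N a] small enough to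
     offset the exponential factor. *)
  pose a := Num.min (d / 2) T.
  have a0 : 0 < a by rewrite lt_min T_gt0 divr_gt0.
  have ad : a < d by rewrite gt_min; apply/orP; left; lra.
  have aT : a <= T by rewrite ge_min lexx orbT.
  have := dP a (ltW a0); rewrite subr0 gtr0_norm// NN0 subr0 ger0_norm// => /(_ ad) Na.
  have := @dini_gronwall R N a T c (ltW a0) c0 N0 cN.
  move=> /(_ _ T) H; apply: le_trans (H _ _) _.
  - move=> t e' /andP[at_ tT]; apply: dN; rewrite tT andbT; exact: lt_le_trans at_.
  - by rewrite aT lexx.
  apply: (@le_trans _ _ (N a * expR ((c + 1) * T))).
    rewrite ler_wpM2l// ler_expR ler_wpM2l//; first by rewrite addr_ge0.
    by rewrite gerBl ltW.
  by rewrite -ler_pdivlMr.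
have [fT1 _] := uv1 T T0.
have n1 := ell1_negpart fT1.
have := @le_term_sumZ R (fun k => Num.max (- f T k) 0) k n1.
rewrite -/(N T) NT => H.
have : Num.max (- f T k) 0 <= 0 by apply: H => j; rewrite le_max lexx orbT.
by rewrite ge_max => /andP[]; rewrite oppr_le0.
Qed.

Lemma solution_mass (R : realType) (K : int -> int -> R) (C : R) (f0 : int -> R)
    (f : R -> int -> R) :
  (forall k l, `|K k l| <= C) -> is_solution K f0 f ->
  forall t, 0 <= t -> mass (f t) = mass f0.
Proof.
move=> KC [v [[uv1 uv _] fQ fE]] T T0.
have [dm cm] := linear_ell1_curve uv1 uv (@sumZB R) (@sumZZ R) (@norm_sumZ_le R).
have dm0 t : 0 < t < T -> is_derive t 1 (fun s => sumZ (f s)) (cst 0 t).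
  move=> /andP[t0 _]; have := dm t t0.
  have [ut1 _] := uv1 t (ltW t0).
  by rewrite (eq_sumZ (fQ t t0)) -/(mass _) (mass_collision KC ut1).
rewrite /mass -(eq_sumZ fE); apply/eqP; rewrite eq_le; apply/andP; split; last first.
  exact: (ge0_derive_le T0 (cm 0 T (lexx 0)) dm0).
(* The derivative is zero, so the negated mass is nondecreasing as well. *)
rewrite -lerN2.
apply: (@ge0_derive_le _ (- (fun t => sumZ (f t))) (cst 0) _ _ T0) => //.
- by move=> t; exact/continuousN/cm.
- by move=> t /dm0 ?; rewrite -[cst 0 t]oppr0; exact: is_deriveN.
Qed.

Lemma solution_coord (R : realType) (K : int -> int -> R) (f0 : int -> R)
    (f : R -> int -> R) (k : int) : is_solution K f0 f ->
  (forall t : R, 0 < t -> is_derive t 1 (fun s => f s k) (collision K (f t) k)) /\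
  (forall a b : R, 0 <= a -> {within `[a, b], continuous (fun s => f s k)}).
Proof.
move=> [v [[uv1 uv _] fQ fE]].
have [dk ck] := @linear_ell1_curve R f v (fun g => g k) uv1 uv
  (fun _ _ _ _ => erefl) (fun _ _ _ => erefl) (fun g => @norm_le_norm1 R g k).
by split => // t t0; rewrite -fQ//; exact: dk.
Qed.

(** * Lower bounds *)

(** With [expR (mu * t)] as integrating factor, [h t * expR (mu * t) - D * t] has a nonnegative
    derivative. *)
Lemma expR_weighted_growth (R : realType) (h dh : R -> R) (a b mu D : R) :
  a <= b -> {within `[a, b], continuous h} ->
  (forall t, a < t < b -> is_derive t 1 h (dh t)) ->
  (forall t, a < t < b -> D <= (dh t + mu * h t) * expR (mu * t)) ->
  h a * expR (mu * a) + D * (b - a) <= h b * expR (mu * b).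
Proof.
move=> ab ch hd DP.
pose H : R -> R := h * (expR \o (mu \*: id)) - D \*: id.
have HE t : H t = h t * expR (mu * t) - D * t by [].
suff : H a <= H b by rewrite !HE; lra.
apply: (@ge0_derive_le _ H (fun t => (dh t + mu * h t) * expR (mu * t) - D)) => //.
- have cl c : {within `[a, b], continuous (c \*: id : R -> R)}.
    by apply: continuous_subspaceT => t; apply: continuousZr; exact: cvg_id.
  move=> t; apply: continuousB; last exact: cl.
  apply: continuousM; first exact: ch.
  apply: continuous_comp; first exact: cl.
  exact: continuous_expR.
- move=> t /hd ht.
  have e1 : is_derive t 1 (expR \o (mu \*: id)) (expR (mu * t) * (mu *: 1)).
    exact: is_derive1_comp.
  have D1 := is_deriveB (is_deriveM ht e1) (is_deriveZ D (is_derive_id t 1)).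
  apply: (is_derive_eq D1).
  have ZM (x y : R^o) : x *: y = x * y by [].
  by rewrite !ZM /=; lra.
- by move=> t /DP; rewrite subr_ge0.
Qed.

Lemma ell1_solution (R : realType) (K : int -> int -> R) (f0 : int -> R)
    (f : R -> int -> R) :
  is_solution K f0 f -> forall t, 0 <= t -> ell1 (f t).
Proof. by move=> [v [[uv1 _ _] _ _]] t /uv1[]. Qed.

(** Positive mass forces some [g l > 0], and the single term [K l k * g l] bounds the sum from
    below. *)
Lemma rise_rate_gt0 (R : realType) (K : int -> int -> R) (C : R) (g : int -> R) k :
  (forall k l, 0 < K k l) -> (forall k l, K k l <= C) -> ell1 g ->
  (forall k, 0 <= g k) -> 0 < mass g -> 0 < rise_rate K g k.
Proof.
move=> K0 KC g1 g0 mg.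
have Kg1 : ell1 (fun l => K l k * g l).
  by apply: (@ell1M _ C (fun l => K l k)) => // l; rewrite gtr0_norm.
have [l gl] : exists l, 0 < g l.
  apply: contrapT => /forallNP ng; move: mg.
  rewrite /mass (@eq_sumZ _ _ (fun=> 0)) ?/sumZ ?Rintegral_cst ?mul0r ?ltxx// => l.
  by apply/eqP; rewrite eq_le g0 andbT leNgt; apply/negP/ng.
apply: (@lt_le_trans _ _ (K l k * g l)); first exact: mulr_gt0.
apply: (@le_term_sumZ _ (fun l => K l k * g l)) => // j.
by rewrite mulr_ge0// ltW.
Qed.

Lemma rise_rate_ge (R : realType) (K : int -> int -> R) (c C : R) (g : int -> R) k :
  0 <= c -> (forall k l, c <= K k l) -> (forall k l, K k l <= C) -> ell1 g ->
  (forall k, 0 <= g k) -> c * mass g <= rise_rate K g k.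
Proof.
move=> c0 cK KC g1 g0.
rewrite /mass -sumZZ//; apply: le_sumZ => [||l]; first exact: ell1Z.
- by apply: (@ell1M _ C (fun l => K l k)) => // l; rewrite ger0_norm// (le_trans c0).
- by rewrite ler_wpM2r.
Qed.

Lemma mass_norm1 (R : realType) (g : int -> R) :
  (forall k, 0 <= g k) -> norm1 g = mass g.
Proof. by move=> g0; apply: eq_sumZ => k; rewrite ger0_norm. Qed.

(** The losses at [k] vanish with [f t k], so the zero derivative at this minimum leaves two
    nonnegative gains of sum zero, both with positive rates. *)
Lemma solution_zero_neighbors (R : realType) (K : int -> int -> R) (C : R)
    (f0 : int -> R) (f : R -> int -> R) (t : R) (k : int) :
  (forall k l, 0 < K k l) -> (forall k l, K k l <= C) ->
  (forall k, 0 <= f0 k) -> 0 < mass f0 -> is_solution K f0 f -> 0 < t ->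
  f t k = 0 -> f t (k - 1) = 0 /\ f t (k + 1) = 0.
Proof.
move=> K0 KC f00 m0 sol t0 ftk.
have K0' i j : 0 <= K i j by exact: ltW.
have KC' i j : `|K i j| <= C by rewrite ger0_norm.
have f_ge0 := solution_ge0 K0' KC f00 sol.
have g0 j : 0 <= f t j by apply: f_ge0; exact: ltW.
have g1 := ell1_solution sol (ltW t0).
have mt : 0 < mass (f t) by rewrite (solution_mass KC' sol (ltW t0)).
have [dk _] := solution_coord k sol.
have t2 : t < t + 1 by rewrite ltrDl.
have dz : is_derive t 1 (fun s => f s k) 0.
  apply: (@derive1_at_min _ _ 0 (t + 1)) => [||| s].
  - by rewrite addr_ge0// ltW.
  - by move=> s; rewrite in_itv/= => /andP[s0 _]; have [] := dk s s0.
  - by rewrite in_itv/= t0 t2.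
  - by rewrite in_itv/= => /andP[s0 _]; rewrite ftk f_ge0// ltW.
have : collision K (f t) k = 0.
  by rewrite -(@derive_val _ _ _ _ _ _ _ (dk t t0)) derive_val.
rewrite (collisionE k KC' g1) ftk !mulr0 !subr0.
have A0 : 0 < rise_rate K (f t) (k - 1) by exact: (rise_rate_gt0 _ K0 KC).
have B0 : 0 < fall_rate K (f t) (k + 1).
  exact: (rise_rate_gt0 _ (fun k l => K0 l k) (fun k l => KC l k)).
move/eqP; rewrite paddr_eq0 ?mulr_ge0 ?(ltW A0) ?(ltW B0)//.
by rewrite !mulf_eq0 (gt_eqF A0) (gt_eqF B0)/= => /andP[/eqP-> /eqP->].
Qed.

Lemma solution_gt0 (R : realType) (K : int -> int -> R) (C : R)
    (f0 : int -> R) (f : R -> int -> R) (t : R) (k : int) :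
  (forall k l, 0 < K k l) -> (forall k l, K k l <= C) ->
  (forall k, 0 <= f0 k) -> 0 < mass f0 -> is_solution K f0 f -> 0 < t ->
  0 < f t k.
Proof.
move=> K0 KC f00 m0 sol t0.
have K0' i j : 0 <= K i j by exact: ltW.
have KC' i j : `|K i j| <= C by rewrite ger0_norm.
rewrite lt_neqAle (solution_ge0 K0' KC f00 sol) ?(ltW t0)// andbT eq_sym.
apply/eqP => ftk.
(* Zeros spread by one site per induction step in both directions, at the same time [t]. *)
have Z n : f t (k + n%:Z) = 0 /\ f t (k - n%:Z) = 0.
  elim: n => [|n [IH1 IH2]]; first by rewrite addr0 ?subr0.
  have [_ Z1] := solution_zero_neighbors K0 KC f00 m0 sol t0 IH1.
  have [Z2 _] := solution_zero_neighbors K0 KC f00 m0 sol t0 IH2.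
  by rewrite -addn1 PoszD opprD !addrA.
have Zj j : f t j = 0.
  have [h1 h2] := Z `|j - k|%N.
  have [jk|/ltW jk] := lerP 0 (j - k).
    by rewrite -h1 gez0_abs// [k + _]addrC subrK.
  by rewrite -h2 lez0_abs// opprK [k + _]addrC subrK.
have := m0; rewrite -(solution_mass KC' sol (ltW t0)) /mass (eq_sumZ Zj).
by rewrite /sumZ Rintegral_cst// mul0r ltxx.
Qed.

(** The weight absorbs the losses, whose total rate is at most [2 * C * mass f0]. Of the two gains,
    the one from [k] is bounded below and the other is dropped by its sign. *)
Lemma solution_growth (R : realType) (K : int -> int -> R) (C c D : R)
    (f0 : int -> R) (f : R -> int -> R) (a b : R) (i k : int) :
  0 <= c -> (forall k l, c <= K k l) -> (forall k l, K k l <= C) ->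
  (forall k, 0 <= f0 k) -> is_solution K f0 f -> 0 <= a <= b ->
  i = k + 1 \/ i = k - 1 ->
  (forall t, a < t < b -> D <= f t k * expR (2 * C * mass f0 * t)) ->
  f a i * expR (2 * C * mass f0 * a) + c * mass f0 * D * (b - a) <=
  f b i * expR (2 * C * mass f0 * b).
Proof.
move=> c0 cK KC f00 sol /andP[a0 ab] ik DP.
have K0 i' j : 0 <= K i' j by exact: le_trans (cK i' j).
have KC' i' j : `|K i' j| <= C by rewrite ger0_norm.
have m0 : 0 <= mass f0 by exact: sumZ_ge0.
have [di ci] := solution_coord i sol.
apply: (@expR_weighted_growth R (fun s => f s i)
  (fun t => collision K (f t) i) _ _ _ _ ab (ci _ _ a0)).
  by move=> t /andP[at_ _]; apply/di/(le_lt_trans a0).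
move=> t /andP[at_ tb].
have t0 : 0 < t by apply: le_lt_trans at_.
have g0 j : 0 <= f t j by apply: (solution_ge0 K0 KC f00 sol); exact: ltW.
have g1 := ell1_solution sol (ltW t0).
have mE : mass (f t) = mass f0 by exact: (solution_mass KC' sol (ltW t0)).
have E0 := expR_gt0 (2 * C * mass f0 * t).
have A0 j : c * mass f0 <= rise_rate K (f t) j.
  by rewrite -mE; exact: (rise_rate_ge _ c0 cK KC).
have B0 j : c * mass f0 <= fall_rate K (f t) j.
  by rewrite -mE; exact: (rise_rate_ge _ c0 (fun k l => cK l k) (fun k l => KC l k)).
have A1 j : rise_rate K (f t) j <= C * mass f0.
  rewrite -mE -(mass_norm1 g0); apply: le_trans (rise_rate_le j KC' g1).
  exact: ler_norm.
have B1 j : fall_rate K (f t) j <= C * mass f0.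
  rewrite -mE -(mass_norm1 g0).
  by apply: le_trans (rise_rate_le j (fun k l => KC' l k) g1); exact: ler_norm.
have cm0 : 0 <= c * mass f0 by rewrite mulr_ge0.
apply: (@le_trans _ _ (c * mass f0 * (f t k * expR (2 * C * mass f0 * t)))).
  by rewrite ler_wpM2l// DP// at_.
rewrite mulrA ler_pM2r// (collisionE i KC' g1).
have L1 : rise_rate K (f t) i * f t i <= C * mass f0 * f t i by rewrite ler_wpM2r.
have L2 : fall_rate K (f t) i * f t i <= C * mass f0 * f t i by rewrite ler_wpM2r.
have G1 : c * mass f0 * f t (i - 1) <= rise_rate K (f t) (i - 1) * f t (i - 1).
  by rewrite ler_wpM2r.
have G2 : c * mass f0 * f t (i + 1) <= fall_rate K (f t) (i + 1) * f t (i + 1).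
  by rewrite ler_wpM2r.
have P1 : 0 <= c * mass f0 * f t (i - 1) by rewrite mulr_ge0.
have P2 : 0 <= c * mass f0 * f t (i + 1) by rewrite mulr_ge0.
by case: ik => ik; [have -> : k = i - 1 by rewrite ik addrK
                   |have -> : k = i + 1 by rewrite ik subrK]; lra.
Qed.

Lemma psumS (R : realType) (a : nat -> R) n : psum a n.+1 = psum a n + a n.+1.
Proof. by rewrite /psum big_nat_recr. Qed.

Lemma psum_ge0 (R : realType) (a : nat -> R) n :
  (forall n, (0 < n)%N -> 0 < a n) -> 0 <= psum a n.
Proof.
by move=> a0; rewrite /psum big_nat_cond sumr_ge0// => i /andP[/andP[/a0/ltW]].
Qed.

Lemma psum_lim_gt0 (R : realType) (a : nat -> R) (sigma : R) :
  (forall n, (0 < n)%N -> 0 < a n) -> psum a n @[n --> \oo] --> sigma -> 0 < sigma.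
Proof.
move=> a0 as_; apply: (@lt_le_trans _ _ (a 1%N)); first exact: a0.
apply: (cvgr_to_ge as_); exists 1%N => // -[//|n] _ /=.
rewrite /psum big_nat_recl//= lerDl big_nat_cond sumr_ge0// => i /andP[/andP[_ _] _].
by rewrite ltW// a0.
Qed.

(** The path [p] treats displacements of either sign in one induction. With the exponential on the
    right, the left side is constant in time and serves as [D] for the next step of
    [solution_growth]. *)
Lemma solution_path_lower_bound (R : realType) (K : int -> int -> R) (C c : R)
    (f0 : int -> R) (f : R -> int -> R) (a : nat -> R) (sigma t0 : R)
    (p : nat -> int) :
  0 < c -> (forall k l, c <= K k l) -> (forall k l, K k l <= C) ->
  (forall k, 0 <= f0 k) -> is_solution K f0 f ->
  (forall n, (0 < n)%N -> 0 < a n) -> 0 < sigma -> 0 < t0 ->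
  (forall n, p n.+1 = p n + 1 \/ p n.+1 = p n - 1) ->
  forall n t, t0 * (psum a n / sigma) <= t ->
    (c * mass f0) ^+ n * f0 (p 0%N)
      * \prod_(1 <= j < n.+1) (2 * C + sigma / (t0 * a j))^-1
    <= f t (p n) * expR (2 * C * mass f0 * t).
Proof.
move=> c0 cK KC f00 sol a0 sigma0 t00 pS.
have K0 i j : 0 <= K i j by apply: le_trans (cK i j); exact: ltW.
have C0 : 0 <= C by exact: le_trans (KC 0 0).
have m0 : 0 <= mass f0 by exact: sumZ_ge0.
have f_ge0 := solution_ge0 K0 KC f00 sol.
have [v [_ _ fE]] := sol.
have tau0 n : 0 <= t0 * (psum a n / sigma).
  by rewrite mulr_ge0 ?(ltW t00)// divr_ge0 ?psum_ge0 ?ltW.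
elim=> [|n IH] t.
  rewrite /psum !big_geq// mul0r mulr0 => t_ge0.
  rewrite expr0 mul1r mulr1.
  (* With [D = 0], the weighted value never falls below its initial value; either neighbour would do
     as source. *)
  have := @solution_growth _ K C c 0 f0 f 0 t (p 0%N) (p 0%N - 1) (ltW c0) cK KC f00 sol.
  rewrite lexx t_ge0 subrK => /(_ isT (or_introl erefl)).
  rewrite mulr0 expR0 fE mulr1 mulr0 mul0r addr0; apply => s /andP[s0 _].
  by rewrite mulr_ge0 ?expR_ge0// f_ge0// ltW.
rewrite psumS mulrDl mulrDr => ht.
set T := t0 * (psum a n / sigma) in ht.
have aS : 0 < a n.+1 by exact: a0.
have d0 : 0 < t0 * (a n.+1 / sigma) by rewrite mulr_gt0// divr_gt0.
have Tt : T <= t by apply: le_trans ht; rewrite lerDl ltW.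
set X := (c * mass f0) ^+ n * f0 (p 0%N)
      * \prod_(1 <= j < n.+1) (2 * C + sigma / (t0 * a j))^-1.
have ik : p n.+1 = p n + 1 \/ p n.+1 = p n - 1 by exact: pS.
have := @solution_growth _ K C c X f0 f T t (p n.+1) (p n) (ltW c0) cK KC f00 sol.
rewrite tau0 Tt => /(_ isT ik) H.
have X0 : 0 <= X.
  rewrite /X !mulr_ge0// ?exprn_ge0 ?mulr_ge0 ?(ltW c0)//.
  rewrite big_nat_cond prodr_ge0// => j /andP[/andP[j0 _] _].
  have aj := ltW (a0 j j0).
  by rewrite invr_ge0 addr_ge0 ?divr_ge0 ?mulr_ge0 ?(ltW sigma0) ?(ltW t00).
apply: (le_trans _ (H _)); last by move=> s /andP[Ts _]; apply: IH; exact: ltW.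
(* The nonnegative weighted value at [T] is dropped, and only the gain over [t - T] is kept. *)
apply: (@le_trans _ _ (c * mass f0 * X * (t - T))); last first.
  by rewrite lerDr mulr_ge0 ?expR_ge0 ?f_ge0 ?tau0.
rewrite exprS big_nat_recr//=.
rewrite [leLHS](_ : _ = c * mass f0 * X * (2 * C + sigma / (t0 * a n.+1))^-1); last first.
  by rewrite /X !mulrA.
have cX0 : 0 <= c * mass f0 * X by rewrite mulr_ge0// mulr_ge0// ltW.
apply: (ler_wpM2l cX0).
(* The time step is the inverse of [sigma / (t0 * a n.+1)], and adding [2 * C] to the latter lowers
   the inverse. *)
apply: (@le_trans _ _ (t0 * (a n.+1 / sigma))); last by rewrite lerBrDl.
have s0 : 0 < sigma / (t0 * a n.+1) by rewrite divr_gt0// mulr_gt0.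
rewrite (_ : t0 * (a n.+1 / sigma) = (sigma / (t0 * a n.+1))^-1); last first.
  by rewrite invf_div mulrA.
by rewrite lef_pV2 ?posrE// ?ltr_wpDl ?lerDr ?mulr_ge0.
Qed.

(** For [1 <= j <= n] monotonicity gives [a n <= a j], so each factor is at least the one with index
    [n]. *)
Lemma prod_invf_ge (R : realType) (C s t0 : R) (a : nat -> R) n :
  0 <= C -> 0 <= s -> 0 < t0 -> (forall n, (0 < n)%N -> 0 < a n) ->
  (forall n m, (0 < n)%N -> (n <= m)%N -> a m <= a n) ->
  (C + s / (t0 * a n)) ^- n <= \prod_(1 <= j < n.+1) (C + s / (t0 * a j))^-1.
Proof.
move=> C0 s0 t00 a0 a_noninc.
(* The hypotheses leave [a 0] arbitrary, but the zeroth power and the empty product are both [1]. *)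
have [->|n0] := eqVneq n 0%N; first by rewrite big_geq// expr0 invr1.
(* For [s = 0] every base is [C], possibly [0], and inverses cannot be compared by positivity; the
   two sides coincide. *)
have [->|sp] := eqVneq s 0.
  rewrite -exprVn mul0r.
  under eq_bigr do rewrite mul0r.
  by rewrite prodr_const_nat subn1.
have sP : 0 < s by rewrite lt_neqAle eq_sym sp.
have P j : (0 < j)%N -> 0 < C + s / (t0 * a j).
  by move=> j0; rewrite ltr_wpDl// divr_gt0// mulr_gt0// a0.
rewrite -exprVn -[X in _ ^+ X](subn1 n.+1) -prodr_const_nat.
rewrite big_nat_cond [leRHS]big_nat_cond; apply: ler_prod => j /andP[/andP[j1 jn] _].
have nP : (0 < n)%N by rewrite lt0n.
rewrite invr_ge0 (ltW (P _ nP))/= lef_pV2 ?posrE ?P//.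
rewrite lerD2l ler_wpM2l// lef_pV2 ?posrE ?mulr_gt0 ?a0// ler_pM2l//.
exact: a_noninc.
Qed.

Theorem proposition3p2 (R : realType) (K : int -> int -> R) (C_K : R)
    (C_K_gt0 : 0 < C_K)
    (K_ge0 : forall k l, 0 <= K k l)
    (K_le : forall k l, K k l <= C_K)
    (f0 : int -> R) (f0_ell1 : ell1 f0)
    (f0_ge0 : forall k, 0 <= f0 k) (mass_f0_gt0 : 0 < mass f0)
    (f : R -> int -> R) (f_sol : is_solution K f0 f) :
  ((forall k l, 0 < K k l) -> forall (t : R) (k : int), 0 < t -> 0 < f t k)
  /\
  (forall c_K : R, 0 < c_K -> (forall k l, c_K <= K k l) ->
   forall (a : nat -> R) (sigma : R),
     (forall n, (0 < n)%N -> 0 < a n) ->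
     psum a n @[n --> \oo] --> sigma ->
   forall t0 : R, 0 < t0 ->
   forall k : int, 0 < f0 k ->
     (forall (l : int) (t : R), t0 * (psum a `|l|%N / sigma) <= t ->
        (c_K * mass f0) ^+ `|l|%N * f0 k * expR (- (2 * C_K * mass f0 * t))
          * \prod_(1 <= j < `|l|%N.+1) (2 * C_K + sigma / (t0 * a j))^-1
        <= f t (k + l))
     /\
     ((forall n m, (0 < n)%N -> (n <= m)%N -> a m <= a n) ->
      forall (l : int) (t : R), t0 * (psum a `|l|%N / sigma) <= t ->
        (c_K * mass f0) ^+ `|l|%N * f0 k * expR (- (2 * C_K * mass f0 * t))
          * (2 * C_K + sigma / (t0 * a `|l|%N)) ^- `|l|%N
        <= f t (k + l))).
Proof.
split=> [K_gt0 t k t0|c c0 cK a sigma a0 as_ t0 t00 k fk].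
  exact: (solution_gt0 k K_gt0 K_le f0_ge0 mass_f0_gt0 f_sol).
have sigma0 := psum_lim_gt0 a0 as_.
have main (l : int) (t : R) : t0 * (psum a `|l|%N / sigma) <= t ->
    (c * mass f0) ^+ `|l|%N * f0 k * expR (- (2 * C_K * mass f0 * t))
      * \prod_(1 <= j < `|l|%N.+1) (2 * C_K + sigma / (t0 * a j))^-1 <= f t (k + l).
  move=> ht.
  (* The path takes unit steps in the direction of [l] and reaches [k + l] after as many steps as
     the absolute value of [l]. *)
  pose s : int := if 0 <= l then 1 else -1.
  pose p (n : nat) : int := k + s * n%:Z.
  have pS n : p n.+1 = p n + 1 \/ p n.+1 = p n - 1.
    rewrite /p -addn1 PoszD mulrDr mulr1 addrA /s.
    by case: ifP => _; [left|right].
  have pl : p `|l|%N = k + l.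
    rewrite /p /s; case: ifPn => [l0|]; first by rewrite mul1r gez0_abs.
    by rewrite -ltNge => /ltW l0; rewrite lez0_abs// mulN1r opprK.
  have := solution_path_lower_bound c0 cK K_le f0_ge0 f_sol a0 sigma0 t00 pS ht.
  rewrite pl /p mulr0 addr0 => H.
  rewrite expRN mulrAC ler_pdivrMr ?expR_gt0//.
split=> // a_noninc l t ht; apply: le_trans (main l t ht).
rewrite ler_wpM2l//.
  by rewrite !mulr_ge0 ?expR_ge0// exprn_ge0// mulr_ge0 ?ltW.
by apply: prod_invf_ge => //; rewrite ?mulr_ge0// ltW.
Qed.
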